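(* Let $f:\mathbb{R}^n\to\mathbb{R}$ and the randomized stochastic quasi-Newton method RSQN be such that AS.1, AS.2, AS.3 and AS.4 hold. Let $N\ge1$ and suppose the stepsizes satisfy $0<\alpha_k\le 2m/(LM^2)$ for all $k=1,\dots,N$, with $\alpha_k<2m/(LM^2)$ for at least one $k\in\{1,\dots,N\}$. Suppose the probability mass function of $R$ is $$P_R(k)=\mathrm{Prob}\{R=k\}=\frac{m\alpha_k-LM^2\alpha_k^2/2}{\sum_{j=1}^N\left(m\alpha_j-LM^2\alpha_j^2/2\right)},\qquad k=1,\dots,N.$$ Then $$\mathbb{E}[\|\nabla f(x_R)\|^2]\le\frac{D_f+\frac{LM^2\sigma^2}{2}\sum_{k=1}^N\frac{\alpha_k^2}{m_k}}{\sum_{k=1}^N\left(m\alpha_k-LM^2\alpha_k^2/2\right)},$$ where $D_f:=f(x_1)-f^{low}$ and the expectation is taken with respect to $R$ and $\xi_{[N]}$.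
   Context: Problem: minimize a (possibly nonconvex) $f$ over $\mathbb{R}^n$, using only stochastic gradients $G(x,\xi)\in\mathbb{R}^n$ returned by a stochastic first-order oracle, where $\xi$ is a random variable whose distribution is supported on a set $\Xi\subseteq\mathbb{R}^d$ not depending on $x$. Algorithm RSQN. Given: a maximum iteration number $N$, a (deterministic) point $x_1\in\mathbb{R}^n$, a positive definite $B_1\in\mathbb{R}^{n\times n}$, stepsizes $\alpha_k$, batch sizes $m_k\ge1$ (integers), positive safeguard parameters $\zeta_k$. Choose $R$ at random in $\{1,\dots,N\}$ with probability mass function $P_R$, independently of all the gradient samples. For $k=1,\dots,R$: $$G_k=\frac1{m_k}\sum_{i=1}^{m_k}G(x_k,\xi_{k,i}),\qquad x_{k+1}=x_k-\alpha_k(B_k^{-1}+\zeta_kI)G_k,$$ and then a symmetric positive definite matrix $B_{k+1}$ is generated (by any rule such that AS.3 and AS.4 below hold). The output is $x_R$. (The iterates $x_1,\dots,x_N$ are regarded as defined by this recursion for all $k\le N$.) Write $\xi_k=(\xi_{k,1},\dots,\xi_{k,m_k})$ and $\xi_{[k]}=(\xi_1,\dots,\xi_k)$. Assumptions. AS.1: $f$ is continuously differentiable, $f(x)\ge f^{low}$ for all $x\in\mathbb{R}^n$, and $\nabla f$ is globally Lipschitz with constant $L>0$. AS.2: all samples $\xi_{k,i}$ are mutually independent (so $\xi_k$ is independent of $\xi_{[k-1]}$ and hence of $x_k$), and for every $k$ and $i$, taking expectation over $\xi_{k,i}$ with $x_k$ fixed, $\mathbb{E}_{\xi_{k,i}}[G(x_k,\xi_{k,i})]=\nabla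 f(x_k)$ and $\mathbb{E}_{\xi_{k,i}}[\|G(x_k,\xi_{k,i})-\nabla f(x_k)\|^2]\le\sigma^2$, where $\sigma>0$. AS.3: there are positive scalars $m,M$ with $mI\preceq B_k^{-1}+\zeta_kI\preceq MI$ for all $k$. AS.4: for every $k\ge2$, the random matrix $B_k$ depends only on $\xi_{[k-1]}$. $\|\cdot\|$ is the Euclidean norm. *)

(* Defs.v *)
From HB Require Import structures.
From mathcomp Require Import all_boot all_order all_algebra.
From mathcomp Require Import finmap.
From mathcomp Require Import all_classical all_reals all_analysis.

Set Implicit Arguments.
Unset Strict Implicit.
Unset Printing Implicit Defensive.

Import Order.TTheory GRing.Theory Num.Theory.
Import numFieldNormedType.Exports.

Local Open Scope classical_set_scope.
Local Open Scope ring_scope.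

(* The norm that the library puts on matrices is the sup norm; it induces the
   same topology, hence the same notions of differentiability and continuity,
   as the Euclidean one. *)
Definition enorm (R : realType) (n : nat) (v : 'cV[R]_n) : R :=
  Num.sqrt (\sum_(i < n) v i 0 ^+ 2).

Definition grad (R : realType) (n : nat) (f : 'cV[R]_n -> R) (x : 'cV[R]_n) :
    'cV[R]_n :=
  \col_(i < n) 'D_(delta_mx i 0) (f : 'cV[R]_n -> R^o) x.

Definition continuously_differentiable (R : realType) (n : nat)
    (f : 'cV[R]_n -> R) : Prop :=
  (forall x : 'cV[R]_n, differentiable (f : 'cV[R]_n -> R^o) x) /\
  continuous (grad f).

Definition qform (R : realType) (n : nat) (A : 'M[R]_n) (v : 'cV[R]_n) : R :=
  (v^T *m A *m v) 0 0.

Definition spd (R : realType) (n : nat) (A : 'M[R]_n) : Prop :=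
  A^T = A /\ forall v : 'cV[R]_n, v != 0 -> 0 < qform A v.

Definition spsd (R : realType) (n : nat) (A : 'M[R]_n) : Prop :=
  A^T = A /\ forall v : 'cV[R]_n, 0 <= qform A v.

Definition loewner_le (R : realType) (n : nat) (A B : 'M[R]_n) : Prop :=
  spsd (B - A).

(* The library has no sigma-algebra on matrices; [borel_mx R p q] is an alias
   of ['M[R]_(p, q)] that carries the Borel one. *)
Definition borel_mx (R : realType) (p q : nat) :=
  g_sigma_algebraType (@open 'M[R]_(p, q)).

Definition mutually_independent (d : measure_display) (Omega : measurableType d)
    (R : realType) (P : probability Omega R) (I : choiceType) (D : set I)
    (F : I -> set (set Omega)) : Prop :=
  forall (J : {fset I}) (E : I -> set Omega),
    (forall i, i \in J -> D i) ->
    (forall i, i \in J -> F i (E i)) ->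
    P (\big[setI/setT]_(i <- J) E i) = (\prod_(i <- J) P (E i))%E.

Definition sigma_of (Omega : Type) (d' : measure_display)
    (T : measurableType d') (X : Omega -> T) : set (set Omega) :=
  [set A | exists2 U : set T, measurable U & A = X @^-1` U].

(* The sigma-algebra generated by the samples of batches 1, ..., K, where batch
   k consists of [xi k i] for [i < b k]. *)
Definition sigma_batches (Omega : Type) (R : realType) (p : nat) (b : nat -> nat)
    (xi : nat -> nat -> Omega -> 'cV[R]_p) (K : nat) : set (set Omega) :=
  <<s [set A | exists k i, [/\ (1 <= k <= K)%N, (i < b k)%N &
                 sigma_of (xi k i : Omega -> borel_mx R p 1) A]] >>.

Definition minibatch (R : realType) (n p : nat)
    (G : 'cV[R]_n -> 'cV[R]_p -> 'cV[R]_n) (b : nat) (x : 'cV[R]_n)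
    (s : nat -> 'cV[R]_p) : 'cV[R]_n :=
  b%:R^-1 *: \sum_(i < b) G x (s i).

(* Main.v *)
Require Import Defs.
From HB Require Import structures.
From mathcomp Require Import all_boot all_order all_algebra.
From mathcomp Require Import finmap.
From mathcomp Require Import all_classical all_reals all_analysis.
From mathcomp Require Import measurable_realfun ring lra.

Set Implicit Arguments.
Unset Strict Implicit.
Unset Printing Implicit Defensive.

Import Order.TTheory GRing.Theory Num.Theory.
Import numFieldNormedType.Exports.

Local Open Scope classical_set_scope.
Local Open Scope ring_scope.

(* Write g_k for the gradient at x_k, e_k for the error of the k-th minibatch
   gradient, H_k for B_k^-1 + zeta_k I and a_k for the k-th stepsize. The
   descent lemma and m I <= H_k <= M I give almost surely
     f(x_{k+1}) <= f(x_k) - m a_k |g_k|^2 - a_k <H_k g_k, e_k>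
                   + L M^2 a_k^2 |g_k + e_k|^2 / 2.
   Order all samples lexicographically. Each sample is independent of the
   sigma-algebra F generated by the earlier ones, so F-measurable quantities
   may be frozen when integrating over it; hence the errors of the individual
   samples are martingale differences. Consequently <H_k g_k, e_k> and
   <g_k, e_k> have mean 0 and E|e_k|^2 <= sigma^2 / m_k, the cross terms within
   a batch being 0 as well. Taking means and telescoping up to a fictitious
   iterate x_{N+1} bounds the sum of (m a_k - L M^2 a_k^2 / 2) E|g_k|^2, which
   is E|g_R|^2 up to normalization because R is independent of all samples. *)

(** * Euclidean geometry and the descent lemma *)

Section Euclidean.
Context {R : realType} {n : nat}.
Implicit Types (u v w : 'cV[R]_n) (A : 'M[R]_n).

Lemma coord_add u v i : (u + v) i 0 = u i 0 + v i 0.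
Proof. by rewrite mxE. Qed.

Lemma coord_sub u v i : (u - v) i 0 = u i 0 - v i 0.
Proof. by rewrite !mxE. Qed.

Definition dotv u v : R := (u^T *m v) 0 0.

Lemma dotvE u v : dotv u v = \sum_(i < n) u i 0 * v i 0.
Proof. by rewrite /dotv mxE; under eq_bigr do rewrite mxE. Qed.

Lemma dotvC u v : dotv u v = dotv v u.
Proof. by rewrite !dotvE; apply: eq_bigr => i _; rewrite mulrC. Qed.

Lemma dotvDl u v w : dotv (u + v) w = dotv u w + dotv v w.
Proof. by rewrite /dotv linearD mulmxDl mxE. Qed.

Lemma dotvZl a u v : dotv (a *: u) v = a * dotv u v.
Proof. by rewrite /dotv linearZ /= -scalemxAl mxE. Qed.

Lemma dotvNl u v : dotv (- u) v = - dotv u v.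
Proof. by rewrite -scaleN1r dotvZl mulN1r. Qed.

Lemma dotvDr u v w : dotv u (v + w) = dotv u v + dotv u w.
Proof. by rewrite dotvC dotvDl !(dotvC u). Qed.

Lemma dotvZr a u v : dotv u (a *: v) = a * dotv u v.
Proof. by rewrite dotvC dotvZl dotvC. Qed.

Lemma dotvNr u v : dotv u (- v) = - dotv u v.
Proof. by rewrite dotvC dotvNl dotvC. Qed.

Lemma dotv_ge0 u : 0 <= dotv u u.
Proof. by rewrite dotvE sumr_ge0// => i _; rewrite -expr2 sqr_ge0. Qed.

Lemma enorm_sqr u : enorm u ^+ 2 = dotv u u.
Proof.
rewrite /enorm sqr_sqrtr; last by rewrite sumr_ge0// => i _; rewrite sqr_ge0.
by rewrite dotvE; apply: eq_bigr => i _; rewrite expr2.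
Qed.

Lemma enorm_ge0 u : 0 <= enorm u.
Proof. exact: sqrtr_ge0. Qed.

Lemma sqr_coord_le u i : u i 0 ^+ 2 <= enorm u ^+ 2.
Proof.
rewrite enorm_sqr dotvE (bigD1 i)//= expr2 lerDl sumr_ge0// => j _.
by rewrite -expr2 sqr_ge0.
Qed.

Lemma qformE A v : qform A v = dotv v (A *m v).
Proof. by rewrite /qform /dotv mulmxA. Qed.

Lemma dotv_sym A u v : A^T = A -> dotv (A *m u) v = dotv u (A *m v).
Proof. by move=> As; rewrite /dotv trmx_mul As mulmxA. Qed.

Lemma loewner_le_scalarl A (a : R) v :
  loewner_le a%:M A -> a * dotv v v <= dotv v (A *m v).
Proof.
move=> [_ /(_ v)]; rewrite qformE mulmxBl mul_scalar_mx.
by rewrite dotvDr dotvNr dotvZr subr_ge0.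
Qed.

Lemma loewner_le_scalarr A (a : R) v :
  loewner_le A a%:M -> dotv v (A *m v) <= a * dotv v v.
Proof.
move=> [_ /(_ v)]; rewrite qformE mulmxBl mul_scalar_mx.
by rewrite dotvDr dotvNr dotvZr subr_ge0.
Qed.

Lemma loewner_le_scalar_sym A (a : R) : loewner_le a%:M A -> A^T = A.
Proof.
move=> [+ _]; rewrite linearB /= tr_scalar_mx => /(congr1 (+%R^~ a%:M)).
by rewrite !subrK.
Qed.

(* Expand [0 <= <v - M^-1 A v, A (v - M^-1 A v)>] and bound the cubic term
   [<A v, A (A v)>] by [M |A v|^2]. *)
Lemma loewner_le_mulmx A (m M : R) v : 0 < m -> 0 < M ->
  loewner_le m%:M A -> loewner_le A M%:M ->
  dotv (A *m v) (A *m v) <= M ^+ 2 * dotv v v.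
Proof.
move=> m0 M0 mA AM; have As := loewner_le_scalar_sym mA.
set w := v - M^-1 *: (A *m v).
have : 0 <= dotv w (A *m w).
  by apply: le_trans (loewner_le_scalarl w mA); rewrite mulr_ge0 ?dotv_ge0 ?ltW.
have := loewner_le_scalarr (A *m v) AM; have := loewner_le_scalarr v AM.
rewrite /w mulmxBr -scalemxAr !(dotvDl, dotvDr, dotvNl, dotvNr, dotvZl, dotvZr).
rewrite -(dotv_sym v (A *m v) As).
move: (dotv v v) (dotv v (A *m v)) (dotv (A *m v) (A *m v)) => a b c.
move: (dotv (A *m v) _) => e h1 h2.
rewrite -(@ler_pM2l _ (M * M)) ?mulr_gt0// mulr0.
have -> : M * M * (b - M^-1 * c + (- (M^-1 * c) - - (M^-1 * (M^-1 * e)))) =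
    M * M * b - 2 * M * c + e by field; rewrite gt_eqF.
move=> h3; have : M * c <= M * (M * b) by nra.
rewrite ler_pM2l// => /le_trans; apply.
by rewrite expr2 -mulrA ler_pM2l.
Qed.

End Euclidean.

Section descent.
Context {R : realType} {n : nat}.
Implicit Types (u v w x y : 'cV[R]_n).

Lemma derive_grad (f : 'cV[R]_n -> R) x v :
  differentiable (f : 'cV[R]_n -> R^o) x ->
  'D_v (f : 'cV[R]_n -> R^o) x = dotv (grad f x) v.
Proof.
move=> df; rewrite deriveE// dotvE {1}(matrix_sum_delta v) linear_sum/=.
apply: eq_bigr => i _; rewrite big_ord1 linearZ/= /grad mxE deriveE//.
by rewrite mulrC.
Qed.

(** The difference quotient of the restriction to the line at [t] is literally that of [f] at
    [x + t *: v] in the direction [v]. *)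
Lemma is_derive_segment (f : 'cV[R]_n -> R) x v (t : R) :
  differentiable (f : 'cV[R]_n -> R^o) (x + t *: v) ->
  is_derive (t : R^o) 1 (fun s : R^o => f (x + s *: v) : R^o)
    (dotv (grad f (x + t *: v)) v).
Proof.
move=> df.
pose fo : 'cV[R]_n -> R^o := f; pose seg (s : R^o) : R^o := f (x + s *: v).
have E : (fun h : R^o => h^-1 *: ((seg \o shift t) (h *: 1) - seg t)) =
    (fun h => h^-1 *: ((fo \o shift (x + t *: v)) (h *: v) - fo (x + t *: v))).
  apply/funext => h /=; congr (_ *: (f _ - _)).
  by rewrite /shift /= scalerDl addrCA [h%:A]mulr1.
apply: DeriveDef.
  by rewrite /derivable E; exact: diff_derivable.
by rewrite /derive E -derive_grad.
Qed.

(** The mean value theorem on [0, 1], applied to [f] along the segment minus its quadratic model,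
    reduces the bound to the sign of one derivative. *)
Lemma descent_lemma (f : 'cV[R]_n -> R) (L : R) : 0 < L ->
  (forall x, differentiable (f : 'cV[R]_n -> R^o) x) ->
  (forall x y, enorm (grad f x - grad f y) <= L * enorm (x - y)) ->
  forall x v, f (x + v) <= f x + dotv (grad f x) v + L / 2 * dotv v v.
Proof.
move=> L0 df Lf x v.
pose g (t : R^o) : R^o :=
  f (x + t *: v) - (t * dotv (grad f x) v + L / 2 * dotv v v * t ^+ 2).
pose dg (t : R^o) : R^o :=
  dotv (grad f (x + t *: v)) v - (dotv (grad f x) v + L * dotv v v * t).
have gd (t : R^o) : is_derive t 1 g (dg t).
  have h1 := is_derive_segment (df (x + t *: v)).
  rewrite /g /dg; apply: is_deriveB.
  apply: is_derive_eq.
  by rewrite /= /GRing.scale /=; field.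
have := @MVT R g dg 0 1 ltr01 (fun t _ => gd t).
case; first by apply: derivable_within_continuous => t _; have [] := gd t.
move=> t /[!in_itv]/= /andP[t0 t1].
rewrite /g /dg subr0 mulr1 scale0r scale1r addr0 !expr2 !mul0r !mul1r !mulr0.
rewrite addr0 subr0 !mulr1.
move=> E.
suff : dotv (grad f (x + t *: v)) v - (dotv (grad f x) v + L * dotv v v * t) <= 0.
  by rewrite -E; lra.
have Lt : 0 < L * t by rewrite mulr_gt0.
have := Lf (x + t *: v) x; rewrite [x + _ - x]addrAC subrr add0r.
rewrite -ler_sqr ?nnegrE ?enorm_ge0//; last first.
  by rewrite mulr_ge0 ?enorm_ge0// ltW.
rewrite exprMn !enorm_sqr dotvZl dotvZr.
(* This square replaces Cauchy-Schwarz: expanded and combined with |u|^2 <= (L t)^2 |v|^2, it gives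
   <u, v> <= L t |v|^2. *)
have := dotv_ge0 (grad f (x + t *: v) - grad f x - (L * t) *: v).
set u := grad f _ - grad f _.
have uE : dotv u v = dotv (grad f (x + t *: v)) v - dotv (grad f x) v.
  by rewrite dotvDl dotvNl.
rewrite opprD addrA -uE; clearbody u.
rewrite !(dotvDl, dotvDr, dotvNl, dotvNr, dotvZl, dotvZr) (dotvC v u).
move: (dotv u u) (dotv u v) (dotv v v) => a b c h1 h2.
rewrite -(@ler_pM2l _ (L * t))// mulr0; nra.
Qed.

End descent.

(** * Borel measurability of matrices *)

Section borel_matrices.
Context {R : realType}.

(** Rational matrices are dense, and the index set is countable; Borel measurability of a
    matrix-valued map thus reduces to preimages of balls. *)
Lemma open_mx_bigcup_ball p q (U : set 'M[R]_(p, q)) : open U ->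
  U = \bigcup_(c in [set c : 'M[rat]_(p, q) * rat |
         ball (map_mx ratr c.1 : 'M[R]_(p, q)) (ratr c.2) `<=` U])
      ball (map_mx ratr c.1 : 'M[R]_(p, q)) (ratr c.2).
Proof.
move=> oU; apply/seteqP; split => [A UA|A [c cU]]; last exact: cU.
have /nbhs_ballP[e /= e0 eU] : nbhs A U by exact: open_nbhs_nbhs.
(* A rational center within [r] of [A] has its whole [r]-ball inside the [e]-ball of [A], since
   [r < e / 2]. *)
have /rat_in_itvoo[r] : 0 < e / 2 by rewrite divr_gt0.
rewrite in_itv/= => /andP[r0 re].
have aprx i j : {s : rat | `|ratr s - A i j| < ratr r}.
  apply/cid; have /rat_in_itvoo[s] : A i j - ratr r < A i j + ratr r.
    by rewrite ltrD2l gt0_cp.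
  by rewrite in_itv/= => sA; exists s; rewrite ltr_distl.
exists (\matrix_(i, j) sval (aprx i j), r).
  move=> B /= [_ cB]; apply: eU; split => // i j.
  have := cB i j; rewrite !mxE /ball /= /ball_ => cBij.
  rewrite (le_lt_trans (ler_distD (ratr (sval (aprx i j))) _ _))//.
  by rewrite (splitr e) ltrD// ?(lt_trans cBij)// distrC (lt_trans (svalP (aprx i j))).
by split => // i j; rewrite !mxE /ball /= /ball_; exact: (svalP (aprx i j)).
Qed.

(** Balls of the sup norm are boxes, hence finite intersections of conditions on single entries. *)
Lemma measurable_fun_mx d (T : measurableType d) p q (X : T -> 'M[R]_(p, q)) :
  (forall i j, measurable_fun setT (fun t => X t i j)) ->
  measurable_fun setT (X : T -> borel_mx R p q).
Proof.
move=> mX.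
apply: (@measurability _ _ T (borel_mx R p q) setT X (@open 'M[R]_(p, q)) erefl).
move=> _ [U oU <-]; rewrite setTI (open_mx_bigcup_ball oU) preimage_bigcup.
rewrite bigcup_mkcond; apply: countable_bigcupT_measurable => // c.
case: ifPn => // _.
(* A ball of matrices requires a positive radius, a condition that entrywise balls lose when the
   matrix has no entry. *)
have [r0|r0] := ltP 0 (ratr c.2 : R); last first.
  rewrite [X in measurable X](_ : _ = set0)//.
  by apply/seteqP; split => // t [/=]; rewrite ltNge r0.
rewrite [X in measurable X](_ : _ = \bigcap_(ij in [set: 'I_p * 'I_q])
   ((fun t => X t ij.1 ij.2) @^-1` ball (ratr (c.1 ij.1 ij.2) : R) (ratr c.2))).
  apply: fin_bigcap_measurable; first exact: finite_finset.
  move=> ij _; rewrite -[X in measurable X]setTI; apply: mX => //.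
  exact: measurable_ball.
apply/seteqP; split => [t [_ tc] [i j] _|t tc]; first by have := tc i j; rewrite mxE.
by split => // i j; rewrite mxE; exact: (tc (i, j)).
Qed.

Lemma continuous_measurable_mx p q (g : 'M[R]_(p, q) -> R) :
  continuous g -> measurable_fun setT (g : borel_mx R p q -> R).
Proof.
move=> /continuousP cg; apply: (measurability _ (RGenOpens.measurableE R)).
move=> _ [_ [a [b ->] <-]]; rewrite setTI.
by apply: sub_sigma_algebra; exact/cg/interval_open.
Qed.

Lemma measurable_coord d (T : measurableType d) p q (X : T -> 'M[R]_(p, q)) i j :
  measurable_fun setT (X : T -> borel_mx R p q) ->
  measurable_fun setT (fun t => X t i j).
Proof.
move=> mX; apply: (measurableT_comp (_ : measurable_fun setT
  (fun A : borel_mx R p q => (A : 'M[R]_(p, q)) i j)) mX).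
apply: continuous_measurable_mx; exact: coord_continuous.
Qed.

Section arithmetic.
Context d (T : measurableType d).

Lemma measurable_fun_mulmx p q r (X : T -> 'M[R]_(p, q)) (Y : T -> 'M[R]_(q, r)) :
  (forall i j, measurable_fun setT (fun t => X t i j)) ->
  (forall i j, measurable_fun setT (fun t => Y t i j)) ->
  forall i j, measurable_fun setT (fun t => (X t *m Y t) i j).
Proof.
move=> mX mY i j; rewrite [X in measurable_fun _ X](_ : _ =
    fun t => \sum_(k < q) X t i k * Y t k j); last by apply/funext => t; rewrite mxE.
by apply: measurable_sum => k; exact: measurable_funM.
Qed.

Lemma measurable_fun_det n (X : T -> 'M[R]_n) :
  (forall i j, measurable_fun setT (fun t => X t i j)) ->
  measurable_fun setT (fun t => \det (X t)).
Proof.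
move=> mX; apply: measurable_sum => s; apply: measurable_funM => //.
by apply: measurable_prod => i _.
Qed.

Lemma measurable_invr : measurable_fun setT (fun r : R => r^-1).
Proof.
(* The power -1 is inversion on nonnegative reals, hence on squares; at 0 both sides are 0. *)
rewrite [X in measurable_fun _ X](_ : _ = fun r => r * (r ^+ 2) `^ (-1)).
  apply: measurable_funM => //.
  have mp : measurable_fun setT (fun a : R => a `^ (-1)) by exact: measurable_powR.
  have mX : measurable_fun setT (fun a : R => a ^+ 2) by exact: exprn_measurable.
  exact: (measurableT_comp mp mX).
apply/funext => r; rewrite powR_inv1 ?sqr_ge0//.
have [->|r0] := eqVneq r 0; first by rewrite invr0 mul0r.
by rewrite expr2 invfM mulrA divff// mul1r.
Qed.

(** By the cofactor formula, the entries are cofactors divided by the determinant. *)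
Lemma measurable_fun_invmx n (X : T -> 'M[R]_n) :
  (forall i j, measurable_fun setT (fun t => X t i j)) ->
  (forall t, X t \in unitmx) ->
  forall i j, measurable_fun setT (fun t => invmx (X t) i j).
Proof.
move=> mX Xu i j; rewrite [X in measurable_fun _ X](_ : _ =
    fun t => (\det (X t))^-1 * ((-1) ^+ (j + i) * \det (row' j (col' i (X t))))).
  apply: measurable_funM.
    by apply: measurableT_comp; [exact: measurable_invr | exact: measurable_fun_det].
  apply: measurable_funM => //; apply: measurable_fun_det => k l.
  by under eq_fun do rewrite !mxE; exact: mX.
by apply/funext => t; rewrite /invmx Xu !mxE.
Qed.

Lemma measurable_dotv n (X Y : T -> 'cV[R]_n) :
  (forall i, measurable_fun setT (fun t => X t i 0)) ->
  (forall i, measurable_fun setT (fun t => Y t i 0)) ->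
  measurable_fun setT (fun t => dotv (X t) (Y t)).
Proof.
move=> mX mY; under eq_fun do rewrite dotvE.
by apply: measurable_sum => k; exact: measurable_funM.
Qed.

End arithmetic.

End borel_matrices.

(** A nonzero vector of the kernel would annihilate the quadratic form. *)
Lemma spd_unitmx (R : realType) n (A : 'M[R]_n) : spd A -> A \in unitmx.
Proof.
move=> [_ Apos]; rewrite -row_free_unit -kermx_eq0; apply/eqP/row_matrixP => i.
rewrite row0; apply: contrapT => /eqP k0.
have := Apos (row i (kermx A))^T; rewrite trmx_eq0 => /(_ k0).
rewrite /qform trmxK (_ : row i (kermx A) *m A = 0) ?mul0mx ?mxE ?ltxx//.
exact/sub_kermxP/row_sub.
Qed.

(** * Independence and freezing *)

Section independence.
Context d (Omega : measurableType d) (R : realType) (P : probability Omega R).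

Definition generated_by (I : Type) (F : I -> set (set Omega)) (D : set I) :
  set (set Omega) := [set A | exists2 i, D i & F i A].

(* The finite intersections of members of the [F i], for [i] in [D'], form a
   pi-system which generates the same sigma-algebra as their union. *)
Lemma mutually_independent_generated (I : choiceType) (D D' : set I) (j : I)
    (F : I -> set (set Omega)) :
  mutually_independent P D F ->
  (forall i, D i -> F i `<=` measurable) ->
  (forall i, D i -> F i setT) ->
  (forall i, D i -> setI_closed (F i)) ->
  D' `<=` D -> D j -> ~ D' j ->
  forall A B, <<s generated_by F D' >> A -> F j B -> P (A `&` B) = (P A * P B)%E.
Proof.
move=> indep Fm FT FI D'D Dj D'j A B sA FB.
have mB : measurable B by exact: Fm FB.
pose G := [set C | exists J : {fset I}, exists E : I -> set Omega,
  [/\ forall i, i \in J -> D' i, forall i, D i -> F i (E i) &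
      C = \big[setI/setT]_(i <- J) E i]].
have mG : G `<=` measurable.
  move=> _ [J [E [JD FE ->]]]; rewrite big_seq; apply: bigsetI_measurable => i iJ.
  by apply: (Fm i); [exact/D'D/JD|exact/FE/D'D/JD].
have GT : G setT.
  exists fset0, (fun=> setT); split => //; last by rewrite big_seq_fset0.
have GI : setI_closed G.
  move=> _ _ [J1 [E1 [J1D FE1 ->]]] [J2 [E2 [J2D FE2 ->]]].
  exists (J1 `|` J2)%fset, (fun i => (if i \in J1 then E1 i else setT) `&`
    (if i \in J2 then E2 i else setT)); split.
  - by move=> i; rewrite inE => /orP[/J1D|/J2D].
  - by move=> i Di; apply: FI => //; case: ifP => _; auto.
  rewrite -!bigcap_seq; apply/seteqP; split => w /=.
    by move=> [w1 w2] i /= _; split; case: ifP => // iJ; [exact: w1|exact: w2].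
  move=> wJ; split => i /= iJ; have := wJ i; rewrite /= inE iJ ?orbT.
    by case/(_ isT).
  by case/(_ isT).
have sG : <<s generated_by F D' >> `<=` <<s G >>.
  apply: smallest_sub; first exact: smallest_sigma_algebra.
  move=> C [i D'i FC]; apply: sub_sigma_algebra.
  exists [fset i]%fset, (fun k => if k == i then C else setT); split.
  - by move=> k; rewrite inE => /eqP ->.
  - by move=> k Dk; case: eqP => [->|_]; auto.
  - by rewrite big_seq_fset1 eqxx.
have PB0 : 0 <= fine (P B) by exact: fine_ge0.
have PBE : (fine (P B))%:E = P B by rewrite fineK// fin_num_measure.
(* Both sides become finite measures in [A]: the restriction of [P] to [B], and [P] scaled by [P B].
   On the pi-system [G] they agree, because adding the index [j] to [J] keeps the product
   formula. *)
rewrite muleC -PBE.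
apply: (@g_sigma_algebra_measure_unique _ _ _ G mG (fun=> setT) _ _
  (mrestr P mB) (mscale (NngNum PB0) P) GI _ _ A (sG _ sA)) => //.
- by rewrite bigcup_const.
- move=> _ [J [E [JD FE ->]]]; rewrite /= /mrestr /mscale /= PBE muleC.
  have jJ : j \notin J by apply/negP => /JD.
  have EB : P ((\big[setI/setT]_(i <- J) E i) `&` B) =
      P (\big[setI/setT]_(i <- (j |` J)%fset) (if i == j then B else E i)).
    rewrite big_fsetU1//= eqxx setIC; congr (P (B `&` _)).
    by apply: eq_big_seq => i iJ; case: eqP jJ iJ => // -> /negbTE ->.
  rewrite EB indep.
  + rewrite big_fsetU1//= eqxx muleC; congr (_ * _)%E.
    rewrite indep; [|by move=> i /JD/D'D|by move=> i /JD/D'D/FE].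
    by apply: eq_big_seq => i iJ; case: eqP jJ iJ => // -> /negbTE ->.
  + by move=> i; rewrite !inE => /orP[/eqP ->//|/JD/D'D].
  + by move=> i; rewrite !inE; case: eqP => [->//|_ /= /JD/D'D/FE].
- by move=> _; rewrite /= /mrestr setTI (le_lt_trans (probability_le1 P mB))// ltry.
Qed.

End independence.

(** The change of variables for nonnegative functions, applied to the positive and negative parts,
    covers every measurable [f], integrable or not. *)
Lemma integral_comp_distribution d d' (Omega : measurableType d)
    (T : measurableType d') (R : realType) (P : probability Omega R)
    (X : {mfun Omega >-> T}) (f : T -> \bar R) :
  measurable_fun setT f ->
  (\int[distribution P X]_y f y = \int[P]_w f (X w))%E.
Proof.
move=> mf; rewrite [LHS]integralE [RHS]integralE.
congr (_ - _)%E.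
  rewrite ge0_integral_distribution//; last exact: measurable_funepos.
  by apply: eq_integral => x _; rewrite -funepos_comp.
rewrite ge0_integral_distribution//; last exact: measurable_funeneg.
by apply: eq_integral => x _; rewrite -funeneg_comp.
Qed.

Section freezing.
Context d d' (Omega : measurableType d) (T : measurableType d') (R : realType)
  (P : probability Omega R).

Variables (S : set (set Omega)) (X : Omega -> T).
Hypotheses (mS : S `<=` measurable) (mX : measurable_fun setT X).
Hypothesis SX : forall A U, <<s S >> A -> measurable U ->
  P (A `&` X @^-1` U) = (P A * P (X @^-1` U))%E.

(** [Omega] itself with the coarser sigma-algebra: the past becomes the random variable [id] with
    values in this space, and has a law there. *)
Let Omega_S : measurableType _ := g_sigma_algebraType S.

Lemma generated_sub : <<s S >> `<=` @measurable _ Omega.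
Proof. by apply: smallest_sub => //; exact: sigma_algebra_measurable. Qed.

Lemma measurable_id_generated : measurable_fun setT (id : Omega -> Omega_S).
Proof. by move=> _ A mA; rewrite setTI; exact: generated_sub. Qed.

Lemma measurable_fun_generated d2 (T2 : measurableType d2) (f : Omega -> T2) :
  measurable_fun setT (f : Omega_S -> T2) -> measurable_fun setT f.
Proof. by move=> mf; exact: (measurableT_comp mf measurable_id_generated). Qed.

Let mpair : measurable_fun setT (fun w => (w, X w) : Omega_S * T).
Proof. by apply: measurable_fun_pair => //; exact: measurable_id_generated. Qed.

Let rvX : {mfun Omega >-> T} := HB.pack X (isMeasurableFun.Build _ _ _ _ X mX).
Let rvid : {mfun Omega >-> Omega_S} := HB.pack (id : Omega -> Omega_S)
  (isMeasurableFun.Build _ _ _ _ (id : Omega -> Omega_S) measurable_id_generated).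
Let rvpair : {mfun Omega >-> (Omega_S * T)%type} := 
  HB.pack (fun w => (w, X w) : Omega_S * T)
  (isMeasurableFun.Build _ _ _ _ _ mpair).

(** Independence is this equality on rectangles, and a product measure is determined by them. *)
Let law_pair A : measurable A ->
  (distribution P rvid \x distribution P rvX)%E A = distribution P rvpair A.
Proof.
apply: product_measure_unique => U V mU mV.
by rewrite /distribution /= /pushforward /= -SX.
Qed.

Let law_pair_sub A : measurable A -> A `<=` setT ->
  (distribution P rvid \x distribution P rvX)%E A = distribution P rvpair A.
Proof. by move=> mA _; exact: law_pair. Qed.

Section function.
Variable h : Omega_S * T -> \bar R.
Hypothesis mh : measurable_fun setT h.

Let inner w0 : (\int[distribution P rvX]_y h (w0, y) = \int[P]_w h (w0, X w))%E.
Proof. by rewrite integral_comp_distribution//; exact: measurableT_comp. Qed.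

(** Tonelli for the product law of the past and [X], pulled back to [Omega] in both variables. *)
Lemma ge0_integral_freezing : (forall z, 0 <= h z)%E ->
  (\int[P]_w h (w, X w) = \int[P]_w0 \int[P]_w h (w0, X w))%E.
Proof.
move=> h0.
have := @fubini_tonelli1 _ _ _ _ _ (distribution P rvid) (distribution P rvX) h mh h0.
rewrite (eq_measure_integral (distribution P rvpair)); last exact: law_pair_sub.
rewrite integral_comp_distribution// /= => ->.
rewrite integral_comp_distribution; last exact: measurable_fun_fubini_tonelli_F.
by apply: eq_integral => w0 _; rewrite /fubini_F inner.
Qed.

Lemma ge0_integral_freezing_le (c : R) : (forall z, 0 <= h z)%E -> 0 <= c ->
  {ae P, forall w0 : Omega, \int[P]_w h (w0, X w) <= c%:E}%E ->
  (\int[P]_w h (w, X w) <= c%:E)%E.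
Proof.
move=> h0 c0 hc; rewrite ge0_integral_freezing//.
have -> : c%:E = (\int[P]_w c%:E)%E.
  by rewrite integral_cst// [X in (_ * X)%E](probability_setT P) mule1.
apply: ae_ge0_le_integral => //.
- by move=> w _; exact: integral_ge0.
- have := @measurable_fun_fubini_tonelli_F _ _ _ _ _ (distribution P rvX) h mh h0.
  move/measurable_fun_generated; apply: eq_measurable_fun => w _.
  by rewrite /fubini_F inner.
by move: hc; apply: filterS => w0 + _; exact.
Qed.

Lemma integral_freezing_eq0 : P.-integrable setT (fun w => h (w, X w)) ->
  {ae P, forall w0 : Omega, \int[P]_w h (w0, X w) = 0}%E ->
  (\int[P]_w h (w, X w) = 0)%E.
Proof.
move=> ih h0.
(* Fubini for signed [h] asks for integrability under the product law, which is the law of the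
   pair. *)
have ih2 : (distribution P rvid \x distribution P rvX)%E.-integrable setT h.
  apply/integrableP; split => //.
  rewrite (eq_measure_integral (distribution P rvpair)); last exact: law_pair_sub.
  rewrite integral_comp_distribution; last exact: measurableT_comp.
  by case/integrableP : ih.
have := integral12_prod_meas1 ih2.
rewrite [in RHS](eq_measure_integral (distribution P rvpair));
  last exact: law_pair_sub.
rewrite [in RHS]integral_comp_distribution// /= => <-.
have mF := measurable_fubini_F ih2.
rewrite integral_comp_distribution//.
rewrite (ae_eq_integral (cst 0%E))//; first by rewrite integral0.
  exact: measurable_fun_generated.
move: h0; apply: filterS => w0 h0 _; rewrite /fubini_F inner; exact: h0.
Qed.

End function.

End freezing.

(** * Square-integrable random variables *)

Section integrable_functions.
Context d (Omega : measurableType d) (R : realType) (P : probability Omega R).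
Implicit Types X Y : Omega -> R.

Definition integrableR X := P.-integrable setT (EFin \o X).

Definition mean X : R := \int[P]_w X w.

Lemma integrableR_measurable X : integrableR X -> measurable_fun setT X.
Proof. by move=> /integrableP[/measurable_EFinP]. Qed.

Lemma mean_EFin X : integrableR X -> (\int[P]_w (X w)%:E = (mean X)%:E)%E.
Proof. by move=> iX; rewrite /mean /Rintegral fineK//; exact: integrable_fin_num. Qed.

Lemma integrableR_cst (a : R) : integrableR (fun=> a).
Proof. exact: finite_measure_integrable_cst. Qed.

Lemma mean_cst (a : R) : mean (fun=> a) = a.
Proof. by rewrite /mean Rintegral_cst// [X in fine X](probability_setT P) mulr1. Qed.

Lemma integrableRD X Y : integrableR X -> integrableR Y ->
  integrableR (fun w => X w + Y w).
Proof. by move=> iX iY; exact: (integrableD _ iX iY). Qed.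

Lemma meanD X Y : integrableR X -> integrableR Y ->
  mean (fun w => X w + Y w) = mean X + mean Y.
Proof. by move=> iX iY; exact: RintegralD. Qed.

Lemma integrableRZ (a : R) X : integrableR X -> integrableR (fun w => a * X w).
Proof. by move=> iX; exact: (integrableZl _ a iX). Qed.

Lemma meanZ (a : R) X : integrableR X -> mean (fun w => a * X w) = a * mean X.
Proof. by move=> iX; exact: RintegralZl. Qed.

Lemma integrableR_sum I (s : seq I) (X : I -> Omega -> R) :
  (forall i, integrableR (X i)) -> integrableR (fun w => \sum_(i <- s) X i w).
Proof.
move=> iX; elim: s => [|i s ih].
  by under eq_fun do rewrite big_nil; exact: integrableR_cst.
by under eq_fun do rewrite big_cons; exact: integrableRD.
Qed.

Lemma mean_sum I (s : seq I) (X : I -> Omega -> R) :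
  (forall i, integrableR (X i)) ->
  mean (fun w => \sum_(i <- s) X i w) = \sum_(i <- s) mean (X i).
Proof.
move=> iX; elim: s => [|i s ih].
  by under eq_fun do rewrite big_nil; rewrite mean_cst big_nil.
under eq_fun do rewrite big_cons.
by rewrite meanD ?ih ?big_cons//; exact: integrableR_sum.
Qed.

Lemma ae_le_integrableR X Y : measurable_fun setT X -> integrableR Y ->
  {ae P, forall w, `|X w| <= Y w} -> integrableR X.
Proof.
move=> mX iY XY; apply/integrableP; split; first exact/measurable_EFinP.
have mY := integrableR_measurable iY.
case/integrableP : iY => _; apply: le_lt_trans.
apply: ae_ge0_le_integral => //.
- by apply: measurableT_comp => //; exact/measurable_EFinP.
- by apply: measurableT_comp => //; exact/measurable_EFinP.
move: XY; apply: filterS => w XY _ /=.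
by rewrite lee_fin (le_trans XY)// ler_norm.
Qed.

(** [Y - X] agrees almost surely with its absolute value, whose mean is nonnegative. *)
Lemma ae_le_mean X Y : integrableR X -> integrableR Y ->
  {ae P, forall w, X w <= Y w} -> mean X <= mean Y.
Proof.
move=> iX iY XY.
have iD : integrableR (fun w => Y w + -1 * X w).
  by apply: integrableRD => //; exact: integrableRZ.
have mD := integrableR_measurable iD.
have : 0 <= mean (fun w => `|Y w + -1 * X w|).
  by apply: Rintegral_ge0.
have -> : mean (fun w => `|Y w + -1 * X w|) = mean (fun w => Y w + -1 * X w).
  congr fine; apply: ae_eq_integral => //.
  - by apply/measurable_EFinP; exact: measurableT_comp.
  - exact/measurable_EFinP.
  by move: XY; apply: filterS => w XY _; rewrite ger0_norm// mulN1r subr_ge0.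
by rewrite meanD ?meanZ//; [rewrite mulN1r subr_ge0|exact: integrableRZ].
Qed.

Lemma integrableR_le X (c : R) : (forall w, 0 <= X w) -> measurable_fun setT X ->
  (\int[P]_w (X w)%:E <= c%:E)%E -> integrableR X /\ mean X <= c.
Proof.
move=> X0 mX Xc; have iX : integrableR X.
  apply/integrableP; split; first exact/measurable_EFinP.
  under eq_integral do rewrite /= ger0_norm//.
  by rewrite (le_lt_trans Xc)// ltry.
by split => //; rewrite -lee_fin -mean_EFin.
Qed.

Definition square_integrable X :=
  measurable_fun setT X /\ integrableR (fun w => X w ^+ 2).

(** The product is dominated by [X ^+ 2 + Y ^+ 2], as the squares of [X + Y] and [X - Y] are
    nonnegative. *)
Lemma square_integrable_mul X Y : square_integrable X -> square_integrable Y ->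
  integrableR (fun w => X w * Y w).
Proof.
move=> [mX iX] [mY iY]; apply: (@ae_le_integrableR _ (fun w => X w ^+ 2 + Y w ^+ 2)).
- exact: measurable_funM.
- exact: integrableRD.
apply: aeW => w /=; rewrite ler_norml; apply/andP; split.
  by have := sqr_ge0 (X w + Y w); have := sqr_ge0 (X w); have := sqr_ge0 (Y w); nra.
by have := sqr_ge0 (X w - Y w); have := sqr_ge0 (X w); have := sqr_ge0 (Y w); nra.
Qed.

Lemma square_integrable_cst (a : R) : square_integrable (fun=> a).
Proof. by split => //; exact: integrableR_cst. Qed.

Lemma square_integrable_integrable X : square_integrable X -> integrableR X.
Proof.
move=> sX; have := square_integrable_mul sX (square_integrable_cst 1).
by under eq_fun do rewrite mulr1.
Qed.

Lemma square_integrableD X Y : square_integrable X -> square_integrable Y ->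
  square_integrable (fun w => X w + Y w).
Proof.
move=> sX sY; have iXY := square_integrable_mul sX sY.
case: sX sY => mX iX [mY iY]; split; first exact: measurable_funD.
under eq_fun do rewrite sqrrD -mulr_natl.
by apply: integrableRD => //; apply: integrableRD => //; exact: integrableRZ.
Qed.

Lemma square_integrableZ (a : R) X : square_integrable X ->
  square_integrable (fun w => a * X w).
Proof.
move=> [mX iX]; split; first exact: measurable_funM.
by under eq_fun do rewrite exprMn; exact: integrableRZ.
Qed.

Lemma square_integrable_sum I (s : seq I) (X : I -> Omega -> R) :
  (forall i, square_integrable (X i)) ->
  square_integrable (fun w => \sum_(i <- s) X i w).
Proof.
move=> iX; elim: s => [|i s ih].
  by under eq_fun do rewrite big_nil; exact: square_integrable_cst.
by under eq_fun do rewrite big_cons; exact: square_integrableD.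
Qed.

Lemma integrable_dotv n (U V : Omega -> 'cV[R]_n) :
  (forall j, square_integrable (fun w => U w j 0)) ->
  (forall j, square_integrable (fun w => V w j 0)) ->
  integrableR (fun w => dotv (U w) (V w)).
Proof.
move=> sU sV; under eq_fun do rewrite dotvE.
by apply: integrableR_sum => j; exact: square_integrable_mul.
Qed.

Lemma square_integrable_coord n (U : Omega -> 'cV[R]_n) (Y : Omega -> R) :
  (forall j, measurable_fun setT (fun w => U w j 0)) -> integrableR Y ->
  {ae P, forall w, dotv (U w) (U w) <= Y w} ->
  forall j, square_integrable (fun w => U w j 0).
Proof.
move=> mU iY UY j; split=> //; apply: (ae_le_integrableR _ iY).
  exact: measurable_funX.
move: UY; apply: filterS => w; apply: le_trans.
by rewrite ger0_norm ?sqr_ge0// -enorm_sqr sqr_coord_le.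
Qed.

End integrable_functions.

(** * Orthogonality of a martingale difference to the past *)

Section martingale_difference.
Context d d' (Omega : measurableType d) (T : measurableType d') (R : realType)
  (P : probability Omega R).
Variables (S : set (set Omega)) (X : Omega -> T).
Hypotheses (mS : S `<=` measurable) (mX : measurable_fun setT X).
Hypothesis SX : forall A U, <<s S >> A -> measurable U ->
  P (A `&` X @^-1` U) = (P A * P (X @^-1` U))%E.

(** Once the past is frozen, [V] is a constant that factors out of an integral equal to 0. *)
Lemma mean_mul_freezing_eq0 (V : Omega -> R) (g : Omega * T -> R) :
  measurable_fun setT (V : g_sigma_algebraType S -> R) ->
  measurable_fun setT (g : g_sigma_algebraType S * T -> R) ->
  square_integrable P V -> square_integrable P (fun w => g (w, X w)) ->
  {ae P, forall w0 : Omega, integrableR P (fun w => g (w0, X w)) /\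
     mean P (fun w => g (w0, X w)) = 0} ->
  mean P (fun w => V w * g (w, X w)) = 0.
Proof.
move=> mV mg sV sg g0; rewrite /mean /Rintegral.
rewrite (integral_freezing_eq0 mS mX SX (h := fun z => (V z.1 * g z)%:E))//.
- apply/measurable_EFinP; apply: measurable_funM => //.
  by apply: measurableT_comp.
- exact: square_integrable_mul.
move: g0; apply: filterS => w0 [ig0 mg0] /=.
by rewrite mean_EFin ?meanZ ?mg0 ?mulr0//; exact: integrableRZ.
Qed.

End martingale_difference.

(** * The stochastic quasi-Newton iteration *)

Section quasi_newton.
Context (R : realType) (n p : nat).
Variables (f : 'cV[R]_n -> R) (flow L : R).
Hypotheses (f_C1 : continuously_differentiable f) (f_low : forall x, flow <= f x)
  (L_gt0 : 0 < L)
  (grad_lip : forall x y, enorm (grad f x - grad f y) <= L * enorm (x - y)).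
Variable G : 'cV[R]_n -> 'cV[R]_p -> 'cV[R]_n.
Hypothesis G_meas : measurable_fun [set: borel_mx R n 1 * borel_mx R p 1]
  (fun z : borel_mx R n 1 * borel_mx R p 1 => G z.1 z.2 : borel_mx R n 1).
Variables (N : nat) (x1 : 'cV[R]_n) (B1 : 'M[R]_n)
  (alpha zeta : nat -> R) (b : nat -> nat).
Hypothesis b_gt0 : forall k, (1 <= k <= N)%N -> (1 <= b k)%N.
Variables (d : measure_display) (Omega : measurableType d)
  (P : probability Omega R) (xi : nat -> nat -> Omega -> 'cV[R]_p).
Hypotheses
  (xi_meas : forall k i, (1 <= k <= N)%N -> (i < b k)%N ->
     measurable_fun [set: Omega] (xi k i : Omega -> borel_mx R p 1))
  (xi_indep : mutually_independent P
     [set ki : nat * nat | (1 <= ki.1 <= N)%N && (ki.2 < b ki.1)%N]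
     (fun ki => sigma_of (xi ki.1 ki.2 : Omega -> borel_mx R p 1))).
Variables (x : nat -> Omega -> 'cV[R]_n) (B : nat -> Omega -> 'M[R]_n).
Hypotheses
  (x_init : forall w, x 1%N w = x1)
  (x_step : forall k w, (1 <= k < N)%N ->
     x k.+1 w = x k w - alpha k *:
       ((invmx (B k w) + (zeta k)%:M) *m
          minibatch G (b k) (x k w) (fun i => xi k i w)))
  (B_init : forall w, B 1%N w = B1)
  (B_spd : forall k w, (1 <= k <= N)%N -> spd (B k w))
  (B_adapted : forall k, (2 <= k <= N)%N -> forall U : set (borel_mx R n n),
     measurable U -> sigma_batches b xi k.-1 (B k @^-1` U)).
Variables (m M : R).
Hypotheses (m_gt0 : 0 < m) (M_gt0 : 0 < M)
  (B_bounds : forall k, (1 <= k <= N)%N ->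
     {ae P, forall w, loewner_le m%:M (invmx (B k w) + (zeta k)%:M) /\
                      loewner_le (invmx (B k w) + (zeta k)%:M) M%:M}).
Variable sigma : R.
Hypotheses
  (G_unbiased : forall k i, (1 <= k <= N)%N -> (i < b k)%N ->
     {ae P, forall w0, forall j : 'I_n,
        ('E_P[(fun w => G (x k w0) (xi k i w) j 0)%R] = (grad f (x k w0) j 0)%:E)%E})
  (G_variance : forall k i, (1 <= k <= N)%N -> (i < b k)%N ->
     {ae P, forall w0,
        ('E_P[(fun w => enorm (G (x k w0) (xi k i w) - grad f (x k w0)) ^+ 2)%R]
          <= (sigma ^+ 2)%:E)%E}).

(** * The lexicographic filtration of the samples *)

Let sample_sigma (ki : nat * nat) : set (set Omega) :=
  sigma_of (xi ki.1 ki.2 : Omega -> borel_mx R p 1).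

(* The samples drawn before [xi k i], in lexicographic order. *)
Definition earlier (k i : nat) : set (nat * nat) :=
  [set ki | ((1 <= ki.1 <= N)%N && (ki.2 < b ki.1)%N) /\
            ((ki.1 < k)%N || (ki.1 == k) && (ki.2 < i)%N)].

Definition history k i : set (set Omega) := generated_by sample_sigma (earlier k i).

Lemma history_sub_measurable k i : history k i `<=` measurable.
Proof.
move=> A [[k' i'] [/andP[k'N i'b] _] [U mU ->]].
by rewrite -[X in measurable X]setTI; exact: xi_meas.
Qed.

Lemma history_mono k i k' i' : (k < k')%N || (k == k') && (i <= i')%N ->
  history k i `<=` history k' i'.
Proof.
move=> kk' A [ki [Dki ki_lt] FA]; exists ki => //; split => //.
move: kk' ki_lt => /orP[kk'|/andP[/eqP <- ii']] /orP[lt|/andP[/eqP eq lt]].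
- by rewrite (ltn_trans lt).
- by rewrite eq kk'.
- by rewrite lt.
- by rewrite eq eqxx (leq_trans lt) ?orbT.
Qed.

(** Batches up to [K] consist of samples strictly before [(K.+1, 0)], and [K <= N] keeps them among
    the indices that [earlier] admits. Adaptedness by batches thus passes to the finer
    filtration. *)
Lemma sigma_batches_history K : (K <= N)%N ->
  sigma_batches b xi K `<=` <<s history K.+1 0 >>.
Proof.
move=> KN; apply: sub_sigma_algebra2 => A [k [i [/andP[k1 kK] ib FA]]].
exists (k, i) => //; split => /=; last by rewrite ltnS kK.
by rewrite k1 (leq_trans kK) //= ib.
Qed.

(** At [K = N] this transfers the independence of the random index to [history N.+1 0]. *)
Lemma history_sigma_batches K : history K.+1 0 `<=` sigma_batches b xi K.
Proof.
move=> A [[k i] /= [/andP[/andP[k1 _] ib]]].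
rewrite ltn0 andbF orbF ltnS => kK FA.
by apply: sub_sigma_algebra; exists k, i; rewrite k1 kK.
Qed.

Lemma history_independent k i : (1 <= k <= N)%N -> (i < b k)%N ->
  forall A (U : set (borel_mx R p 1)), <<s history k i >> A -> measurable U ->
  P (A `&` xi k i @^-1` U) = (P A * P (xi k i @^-1` U))%E.
Proof.
move=> kN ib A U sA mU.
apply: (mutually_independent_generated (D' := earlier k i) (j := (k, i)) xi_indep) => //.
- move=> [k' i'] /= /andP[k'N i'b] _ [V mV ->].
  by rewrite -[X in measurable X]setTI; exact: xi_meas.
- by move=> ki _; exists setT => //; rewrite preimage_setT.
- move=> ki _ _ _ [V1 mV1 ->] [V2 mV2 ->]; exists (V1 `&` V2) => //.
  exact: measurableI.
- by move=> ki [].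
- by rewrite /= kN.
- by move=> [_ /=]; rewrite !ltnn eqxx.
- by exists U.
Qed.

(** * Adaptedness of the iterates and of the scaling matrices *)

Local Notation Om k i := (g_sigma_algebraType (history k i)).

Lemma measurable_history_mono k i k' i' d2 (T2 : measurableType d2) (X : Omega -> T2) :
  (k < k')%N || (k == k') && (i <= i')%N ->
  measurable_fun setT (X : Om k i -> T2) -> measurable_fun setT (X : Om k' i' -> T2).
Proof.
move=> kk' mX _ U mU.
have := mX measurableT U mU; apply: sub_sigma_algebra2; exact: history_mono.
Qed.

Lemma measurable_sample k i k' i' : (1 <= k <= N)%N -> (i < b k)%N ->
  (k < k')%N || (k == k') && (i < i')%N ->
  measurable_fun setT (xi k i : Om k' i' -> borel_mx R p 1).
Proof.
move=> kN ib kk' _ U mU; rewrite setTI; apply: sub_sigma_algebra.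
by exists (k, i); [split => //=; rewrite kN | exists U].
Qed.

(** Adaptedness is assumed from the second matrix on; the first one is constant. *)
Lemma measurable_B k : (1 <= k <= N)%N ->
  measurable_fun setT (B k : Om k 0 -> borel_mx R n n).
Proof.
move=> /andP[k1 kN]; have [k2|] := ltnP 1 k.
  move=> _ U mU; rewrite setTI.
  have := B_adapted (k := k); rewrite k2 kN => /(_ isT _ mU).
  move/sigma_batches_history; rewrite prednK//; apply.
  by rewrite (leq_trans (leq_pred _)).
move=> k1'; have -> : k = 1%N by apply/eqP; rewrite eqn_leq k1 k1'.
by rewrite (_ : B 1 = cst B1); [exact: measurable_cst|exact/funext].
Qed.

(** The update as a function of its own: [x] obeys the recursion only up to [N], so [next N] serves
    as the fictitious last iterate. *)
Definition next k w : 'cV[R]_n := x k w - alpha k *: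
  ((invmx (B k w) + (zeta k)%:M) *m minibatch G (b k) (x k w) (fun i => xi k i w)).

Lemma measurable_oracle k i k' i' : (1 <= k <= N)%N -> (i < b k)%N ->
  (k < k')%N || (k == k') && (i < i')%N ->
  measurable_fun setT (x k : Om k 0 -> borel_mx R n 1) -> forall j,
  measurable_fun setT (fun w : Om k' i' => G (x k w) (xi k i w) j 0).
Proof.
move=> kN ib kk' mx j; apply: measurable_coord.
have mpair : measurable_fun setT
    (fun w : Om k' i' => (x k w, xi k i w) : borel_mx R n 1 * borel_mx R p 1).
  apply: measurable_fun_pair; last exact: measurable_sample.
  apply: measurable_history_mono mx.
  by case/orP: kk' => [->//|/andP[-> _]]; rewrite orbT.
exact: (measurableT_comp G_meas mpair).
Qed.

Lemma measurable_next k : (1 <= k <= N)%N ->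
  measurable_fun setT (x k : Om k 0 -> borel_mx R n 1) ->
  measurable_fun setT (next k : Om k.+1 0 -> borel_mx R n 1).
Proof.
move=> kN mx; apply: measurable_fun_mx => i j; rewrite ord1 /next {j}.
have lt : (k < k.+1)%N || (k == k.+1) && (0 <= 0)%N by rewrite ltnSn.
under eq_fun do rewrite 3!mxE.
apply: measurable_funD.
  by apply: measurable_coord; exact: measurable_history_mono mx.
apply: measurable_funN; apply: measurable_funM => //.
apply: measurable_fun_mulmx => {i} i j.
  under eq_fun do rewrite mxE; apply: measurable_funD => //.
  apply: measurable_fun_invmx => [i' j'|w]; last exact/spd_unitmx/B_spd.
  by apply: measurable_coord; exact: measurable_history_mono (measurable_B kN).
under eq_fun do rewrite mxE summxE; apply: measurable_funM => //.
apply: measurable_sum => l; rewrite ord1.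
by apply: measurable_oracle => //; rewrite ltnSn.
Qed.

Lemma measurable_x k : (1 <= k <= N)%N ->
  measurable_fun setT (x k : Om k 0 -> borel_mx R n 1).
Proof.
elim: k => // k ih /andP[_ kN]; case: k => [|k] in ih kN *.
  by rewrite (_ : x 1 = cst x1); [exact: measurable_cst|exact/funext].
rewrite (_ : x k.+2 = next k.+1); last by apply/funext => w; rewrite x_step.
by apply: measurable_next; [rewrite (ltnW kN)|apply: ih; rewrite (ltnW kN)].
Qed.

Lemma measurable_grad_comp d2 (T2 : measurableType d2) (X : T2 -> 'cV[R]_n) :
  measurable_fun setT (X : T2 -> borel_mx R n 1) -> forall j,
  measurable_fun setT (fun t => grad f (X t) j 0).
Proof.
move=> mX j.
have cg : continuous (fun v => grad f v j 0).
  move=> v; apply: (@continuous_comp _ _ _ (grad f) (fun u : 'cV[R]_n => u j 0)).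
    exact: (f_C1.2 v).
  exact: coord_continuous.
exact: (measurableT_comp (continuous_measurable_mx cg) mX).
Qed.

Lemma measurable_f_comp d2 (T2 : measurableType d2) (X : T2 -> 'cV[R]_n) :
  measurable_fun setT (X : T2 -> borel_mx R n 1) ->
  measurable_fun setT (fun t => f (X t)).
Proof.
move=> mX.
have cf : continuous f by move=> v; exact: (differentiable_continuous (f_C1.1 v)).
exact: (measurableT_comp (continuous_measurable_mx cf) mX).
Qed.

(** * Moments of the noise of a single sample *)

Definition noise k i w : 'cV[R]_n := G (x k w) (xi k i w) - grad f (x k w).

Lemma measurable_noise k i i' : (1 <= k <= N)%N -> (i < b k)%N -> (i < i')%N ->
  forall j, measurable_fun setT (fun w : Om k i' => noise k i w j 0).
Proof.
move=> kN ib ii' j; under eq_fun do rewrite 2!mxE.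
have mx := measurable_x kN.
apply: measurable_funB.
  by apply: measurable_oracle => //; rewrite ltnn eqxx.
apply: measurable_grad_comp; apply: measurable_history_mono mx.
by rewrite eqxx orbT.
Qed.

(** Freezing requires joint measurability in the past and in a free sample value, not only along
    [xi k i]. *)
Lemma measurable_centered_oracle k i : (1 <= k <= N)%N -> forall j,
  measurable_fun setT (fun z : Om k i * borel_mx R p 1 =>
    (G (x k z.1) z.2 - grad f (x k z.1)) j 0).
Proof.
move=> kN j; under eq_fun do rewrite 2!mxE.
have mx : measurable_fun setT 
    (fun z : Om k i * borel_mx R p 1 => x k z.1 : borel_mx R n 1).
  have mx := measurable_x kN.
  have {}mx : measurable_fun setT (x k : Om k i -> borel_mx R n 1).
    by apply: measurable_history_mono mx; rewrite eqxx orbT.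
  exact: (measurableT_comp mx measurable_fst).
apply: measurable_funB; last exact: measurable_grad_comp.
apply: measurable_coord.
have mpair : measurable_fun setT (fun z : Om k i * borel_mx R p 1 =>
    (x k z.1, z.2) : borel_mx R n 1 * borel_mx R p 1) by exact: measurable_fun_pair.
exact: (measurableT_comp G_meas mpair).
Qed.

(** Freezing applies to nonnegative integrands before integrability is known, so the variance bound
    at frozen iterates yields both claims. *)
Lemma integrable_noise k i : (1 <= k <= N)%N -> (i < b k)%N ->
  integrableR P (fun w => enorm (noise k i w) ^+ 2) /\
  mean P (fun w => enorm (noise k i w) ^+ 2) <= sigma ^+ 2.
Proof.
move=> kN ib; apply: integrableR_le.
- by move=> w; exact: sqr_ge0.
- under eq_fun do rewrite enorm_sqr.
  apply: measurable_dotv => j; apply: (measurable_fun_generated (@history_sub_measurable k i.+1));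
  exact: measurable_noise.
apply: (ge0_integral_freezing_le (@history_sub_measurable k i) (xi_meas kN ib)
  (history_independent kN ib)
  (h := fun z => (enorm (G (x k z.1) z.2 - grad f (x k z.1)) ^+ 2)%:E)).
- apply/measurable_EFinP; under eq_fun do rewrite enorm_sqr.
  by apply: measurable_dotv => j; exact: measurable_centered_oracle.
- by move=> z; rewrite lee_fin sqr_ge0.
- exact: sqr_ge0.
by move: (G_variance kN ib); apply: filterS => w0; rewrite unlock.
Qed.

Lemma square_integrable_noise k i : (1 <= k <= N)%N -> (i < b k)%N ->
  forall j, square_integrable P (fun w => noise k i w j 0).
Proof.
move=> kN ib; apply: (square_integrable_coord _ (integrable_noise kN ib).1).
  move=> j; apply: (measurable_fun_generated (@history_sub_measurable k i.+1)).
  exact: measurable_noise.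
by apply: aeW => w; rewrite enorm_sqr.
Qed.

Lemma mean_mul_noise k i (V : Omega -> R) j : (1 <= k <= N)%N -> (i < b k)%N ->
  measurable_fun setT (V : Om k i -> R) -> square_integrable P V ->
  mean P (fun w => V w * noise k i w j 0) = 0.
Proof.
move=> kN ib mV sV.
apply: (mean_mul_freezing_eq0 (@history_sub_measurable k i) (xi_meas kN ib)
  (history_independent kN ib)
  (g := fun z => (G (x k z.1) z.2 - grad f (x k z.1)) j 0)) => //.
- exact: measurable_centered_oracle.
- exact: square_integrable_noise.
move: (G_variance kN ib) (G_unbiased kN ib); apply: filterS2 => w0 /=.
rewrite unlock => var unb.
pose c := grad f (x k w0).
have mg j' : measurable_fun setT (fun w => (G (x k w0) (xi k i w) - c) j' 0).
  have mpair : measurable_fun setT (fun w => (w0, xi k i w) : Om k i * borel_mx R p 1).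
    by apply: measurable_fun_pair => //; exact: xi_meas.
  exact: (measurableT_comp (measurable_centered_oracle kN j') mpair).
have mE : measurable_fun setT (fun w => enorm (G (x k w0) (xi k i w) - c) ^+ 2).
  by under eq_fun do rewrite enorm_sqr; exact: measurable_dotv.
have [ie _] := integrableR_le (fun w => sqr_ge0 _) mE var.
have ig : integrableR P (fun w => (G (x k w0) (xi k i w) - c) j 0).
  apply: square_integrable_integrable; apply: (square_integrable_coord mg ie).
  by apply: aeW => w; rewrite enorm_sqr.
split => //.
(* Unbiasedness concerns the raw oracle value, recovered by adding the constant [c j 0] back to the
   centered one; integrability of the latter came from the variance bound. *)
have := meanD ig (integrableR_cst P (c j 0)).
under eq_fun do rewrite 2!mxE subrK.
rewrite mean_cst {1}/mean /Rintegral unb /= => /eqP.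
by rewrite -subr_eq subrr => /eqP <-.
Qed.

(** * Moments of the minibatch noise *)

Definition avg_noise k w : 'cV[R]_n := (b k)%:R^-1 *: \sum_(i < b k) noise k i w.

Lemma minibatch_noise k w : (1 <= k <= N)%N ->
  minibatch G (b k) (x k w) (fun i => xi k i w) = grad f (x k w) + avg_noise k w.
Proof.
move=> /b_gt0 bk; rewrite /minibatch /avg_noise.
have -> : grad f (x k w) = (b k)%:R^-1 *: ((b k)%:R *: grad f (x k w)).
  by rewrite scalerA mulVf ?scale1r// pnatr_eq0 -lt0n.
rewrite -scalerDr; congr (_ *: _).
by rewrite scaler_nat sumrB sumr_const card_ord addrC subrK.
Qed.

Lemma avg_noise_coord k w j :
  avg_noise k w j 0 = (b k)%:R^-1 * \sum_(i < b k) noise k i w j 0.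
Proof. by rewrite mxE summxE. Qed.

Lemma square_integrable_avg_noise k : (1 <= k <= N)%N -> forall j,
  square_integrable P (fun w => avg_noise k w j 0).
Proof.
move=> kN j; under eq_fun do rewrite avg_noise_coord.
apply: square_integrableZ; apply: square_integrable_sum => i.
exact: square_integrable_noise.
Qed.

(** [U] is known before batch [k] starts, hence before each of its samples; linearity reduces the
    claim to single coordinates of single noises. *)
Lemma mean_dotv_avg_noise k (U : Omega -> 'cV[R]_n) : (1 <= k <= N)%N ->
  (forall j, measurable_fun setT (fun w : Om k 0 => U w j 0)) ->
  (forall j, square_integrable P (fun w => U w j 0)) ->
  mean P (fun w => dotv (U w) (avg_noise k w)) = 0.
Proof.
move=> kN mU sU; under eq_fun do rewrite dotvE.
rewrite mean_sum; last first.
  by move=> j; apply: square_integrable_mul => //; exact: square_integrable_avg_noise.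
rewrite big1// => j _.
under eq_fun do rewrite avg_noise_coord mulrCA mulr_sumr.
have iUn (i : 'I_(b k)) : integrableR P (fun w => U w j 0 * noise k i w j 0).
  by apply: square_integrable_mul => //; exact: square_integrable_noise.
rewrite meanZ ?mean_sum//; last exact: integrableR_sum.
rewrite big1 ?mulr0// => i _; apply: mean_mul_noise => //.
by apply: measurable_history_mono (mU j); rewrite eqxx orbT.
Qed.

(** Induction on [l]: the cross term multiplies the next noise by the partial sum, which depends
    only on earlier samples, so its mean is 0. *)
Lemma mean_sqr_sum_noise k l j : (1 <= k <= N)%N -> (l <= b k)%N ->
  mean P (fun w => (\sum_(i < l) noise k i w j 0) ^+ 2) =
  \sum_(i < l) mean P (fun w => noise k i w j 0 ^+ 2).
Proof.
move=> kN; elim: l => [|l ih] lb.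
  by under eq_fun do rewrite big_ord0 expr0n; rewrite mean_cst big_ord0.
have sl := square_integrable_noise kN lb j.
have ssum : square_integrable P (fun w => \sum_(i < l) noise k i w j 0).
  apply: square_integrable_sum => i; apply: square_integrable_noise => //.
  exact: ltn_trans lb.
under eq_fun do rewrite big_ord_recr /= sqrrD -mulr_natl.
have iX := square_integrable_mul ssum sl.
rewrite !meanD ?meanZ//; [|exact: ssum.2|exact: integrableRZ| |exact: sl.2]; last first.
  by apply: integrableRD; [exact: ssum.2|exact: integrableRZ].
rewrite ih ?(ltnW lb)// big_ord_recr /= mean_mul_noise ?mulr0 ?addr0//.
apply: measurable_sum => i; apply: measurable_noise => //.
exact: ltn_trans lb.
Qed.

(** Orthogonality holds in each coordinate. Exchanging the sums recombines coordinates into [b k]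
    squared norms of mean at most [sigma ^+ 2], against a prefactor [(b k)%:R ^- 2]. *)
Lemma mean_sqr_avg_noise k : (1 <= k <= N)%N ->
  mean P (fun w => dotv (avg_noise k w) (avg_noise k w)) <= sigma ^+ 2 / (b k)%:R.
Proof.
move=> kN; have bk : 0 < (b k)%:R :> R by rewrite ltr0n b_gt0.
have sn (i : 'I_(b k)) := square_integrable_noise kN (ltn_ord i).
under eq_fun do rewrite dotvE.
under eq_fun do under eq_bigr do rewrite avg_noise_coord -expr2 exprMn.
have is2 j : integrableR P (fun w => (\sum_(i < b k) noise k i w j 0) ^+ 2).
  by have [] := square_integrable_sum (index_enum _) (fun i => sn i j).
rewrite mean_sum; last by move=> j; exact: integrableRZ.
under eq_bigr do rewrite meanZ// mean_sqr_sum_noise//.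
rewrite -mulr_sumr exchange_big/=.
have le i : (i < b k)%N ->
    \sum_(j < n) mean P (fun w => noise k i w j 0 ^+ 2) <= sigma ^+ 2.
  move=> ib; rewrite -mean_sum; last first.
    by move=> j; exact: (square_integrable_noise kN ib j).2.
  have [_] := integrable_noise kN ib; congr (_ <= _); congr mean; apply/funext => w.
  by rewrite enorm_sqr dotvE; under eq_bigr do rewrite -expr2.
rewrite exprVn ler_pdivrMl ?exprn_gt0//.
have -> : (b k)%:R ^+ 2 * (sigma ^+ 2 / (b k)%:R) = \sum_(i < b k) sigma ^+ 2.
  by rewrite sumr_const card_ord -mulr_natl; field; rewrite gt_eqF.
by apply: ler_sum => i _; exact: le.
Qed.

Definition scaling k w : 'M[R]_n := invmx (B k w) + (zeta k)%:M.

Lemma nextE k w : (1 <= k <= N)%N -> next k w =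
  x k w + - alpha k *: (scaling k w *m (grad f (x k w) + avg_noise k w)).
Proof. by move=> kN; rewrite /next minibatch_noise// scaleNr. Qed.

Lemma measurable_grad_x k : (1 <= k <= N)%N -> forall j,
  measurable_fun setT (fun w : Om k 0 => grad f (x k w) j 0).
Proof. by move=> kN; apply: measurable_grad_comp; exact: measurable_x. Qed.

Lemma measurable_scaling_grad k : (1 <= k <= N)%N -> forall j,
  measurable_fun setT (fun w : Om k 0 => (scaling k w *m grad f (x k w)) j 0).
Proof.
move=> kN j; apply: measurable_fun_mulmx => i i'; last first.
  by rewrite ord1; exact: measurable_grad_x.
under eq_fun do rewrite mxE; apply: measurable_funD => //.
apply: measurable_fun_invmx => [i'' j''|w]; last exact/spd_unitmx/B_spd.
by apply: measurable_coord; exact: measurable_B.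
Qed.

(** This is also the unnormalized probability of the index [k]. *)
Definition decrease_coef k : R := m * alpha k - L * M ^+ 2 * alpha k ^+ 2 / 2.

(** * Expected decrease in one iteration *)

Section one_step.
Variable k : nat.
Hypotheses (kN : (1 <= k <= N)%N) (alpha_ge0 : 0 <= alpha k)
  (sg : forall j, square_integrable P (fun w => grad f (x k w) j 0))
  (ifx : integrableR P (fun w => f (x k w))).

Let g w := grad f (x k w).
Let e := avg_noise k.
Let H := scaling k.

Let se : forall j, square_integrable P (fun w => e w j 0).
Proof. exact: square_integrable_avg_noise. Qed.

Let igg : integrableR P (fun w => dotv (g w) (g w)).
Proof. exact: integrable_dotv. Qed.

Let iee : integrableR P (fun w => dotv (e w) (e w)).
Proof. exact: integrable_dotv. Qed.

Let ige : integrableR P (fun w => dotv (g w) (e w)).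
Proof. exact: integrable_dotv. Qed.

Let sqr_gradE w : dotv (g w + e w) (g w + e w) =
  dotv (g w) (g w) + (2 * dotv (g w) (e w) + dotv (e w) (e w)).
Proof. by rewrite dotvDl !dotvDr (dotvC (e w) (g w)); ring. Qed.

Let isq : integrableR P (fun w => dotv (g w + e w) (g w + e w)).
Proof.
under eq_fun do rewrite sqr_gradE.
by apply: integrableRD => //; apply: integrableRD => //; exact: integrableRZ.
Qed.

(** The gradient at the iterate is known before batch [k], so the cross term averages to 0. *)
Let mean_sq : mean P (fun w => dotv (g w + e w) (g w + e w)) =
  mean P (fun w => dotv (g w) (g w)) + mean P (fun w => dotv (e w) (e w)).
Proof.
under eq_fun do rewrite sqr_gradE.
rewrite meanD//; last by apply: integrableRD => //; exact: integrableRZ.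
rewrite meanD//; last exact: integrableRZ.
rewrite meanZ// mean_dotv_avg_noise ?mulr0 ?add0r// => j.
exact: measurable_grad_x.
Qed.

Let sHg : forall j, square_integrable P (fun w => (H w *m g w) j 0).
Proof.
apply: (@square_integrable_coord _ _ _ P _ _ (fun w => M ^+ 2 * dotv (g w) (g w))).
- move=> j; apply: (measurable_fun_generated (@history_sub_measurable k 0)).
  exact: measurable_scaling_grad.
- exact: integrableRZ.
move: (B_bounds kN); apply: filterS => w [mH HM].
exact: (loewner_le_mulmx (g w) m_gt0 M_gt0 mH HM).
Qed.

Let iHge : integrableR P (fun w => dotv (H w *m g w) (e w)).
Proof. exact: integrable_dotv. Qed.

Let sqr_step_le : {ae P, forall w,
  dotv (H w *m (g w + e w)) (H w *m (g w + e w)) <=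
  M ^+ 2 * dotv (g w + e w) (g w + e w)}.
Proof.
move: (B_bounds kN); apply: filterS => w [mH HM].
exact: (loewner_le_mulmx (g w + e w) m_gt0 M_gt0 mH HM).
Qed.

Let measurable_next_Omega : measurable_fun setT (next k : Omega -> borel_mx R n 1).
Proof.
apply: (measurable_fun_generated (@history_sub_measurable k.+1 0)).
by apply: measurable_next => //; exact: measurable_x.
Qed.

(** The Lipschitz condition bounds the change of the gradient by [L] times the step length, itself
    at most [alpha k * M] times the norm of [g + e]. Square integrability thus passes to the next
    point. *)
Lemma square_integrable_grad_next j :
  square_integrable P (fun w => grad f (next k w) j 0).
Proof.
have sU : square_integrable P (fun w => (grad f (next k w) - g w) j 0).
  apply: (square_integrable_coord _ (integrableRZ (L ^+ 2 * alpha k ^+ 2 * M ^+ 2) isq)).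
    move=> i; under eq_fun do rewrite coord_sub.
    apply: measurable_funB; last by have [] := sg i.
    exact: measurable_grad_comp.
  move: sqr_step_le; apply: filterS => w sqr_le.
  rewrite -enorm_sqr -2!mulrA.
  apply: (@le_trans _ _ (L ^+ 2 * enorm (next k w - x k w) ^+ 2)).
    rewrite -exprMn ler_sqr ?nnegrE ?mulr_ge0 ?enorm_ge0 ?(ltW L_gt0)//.
    exact: grad_lip.
  rewrite nextE// addrAC subrr add0r enorm_sqr dotvZl dotvZr.
  rewrite [- _ * _]mulrA mulrNN -expr2.
  by rewrite ler_pM2l ?exprn_gt0// ler_wpM2l ?sqr_ge0.
under eq_fun => w do rewrite -[grad f (next k w)](subrK (g w)) coord_add.
exact: square_integrableD.
Qed.

(** The bound of the descent lemma once [H] is replaced by [m] in the term <g, H g> and by [M] in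
    the quadratic term. *)
Let upper w := f (x k w) + (- (alpha k * m) * dotv (g w) (g w) +
  (- alpha k * dotv (H w *m g w) (e w) +
   L / 2 * alpha k ^+ 2 * M ^+ 2 * dotv (g w + e w) (g w + e w))).

Let next_le : {ae P, forall w, f (next k w) <= upper w}.
Proof.
move: (B_bounds kN) sqr_step_le; apply: filterS2 => w [mH _] sqr_le.
have {}mH : loewner_le m%:M (H w) := mH.
rewrite nextE// -/(g w) -/(e w) -/(H w).
apply: (le_trans (descent_lemma L_gt0 f_C1.1 grad_lip _ _)).
rewrite -/(g w) /upper -addrA lerD2l.
have -> : dotv (g w) (- alpha k *: (H w *m (g w + e w))) =
    - alpha k * (dotv (g w) (H w *m g w) + dotv (H w *m g w) (e w)).
  by rewrite dotvZr mulmxDr dotvDr (dotv_sym _ _ (loewner_le_scalar_sym mH)).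
have -> : dotv (- alpha k *: (H w *m (g w + e w))) (- alpha k *: (H w *m (g w + e w))) =
    alpha k ^+ 2 * dotv (H w *m (g w + e w)) (H w *m (g w + e w)).
  by rewrite dotvZl dotvZr; ring.
have := ler_wpM2l alpha_ge0 (loewner_le_scalarl (g w) mH).
have := ler_wpM2l (mulr_ge0 (ltW (divr_gt0 L_gt0 (ltr0n R 2))) (sqr_ge0 (alpha k))) sqr_le.
move: (dotv (g w) (g w)) (dotv (H w *m g w) (e w)) (dotv (g w) (H w *m g w)).
move: (dotv (g w + e w) _) (dotv (H w *m (g w + e w)) _).
by move=> c1 c2 c3 c4 c5; lra.
Qed.

Let iupper : integrableR P upper.
Proof.
apply: integrableRD => //; apply: integrableRD; first exact: integrableRZ.
by apply: integrableRD; exact: integrableRZ.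
Qed.

Lemma integrable_f_next : integrableR P (fun w => f (next k w)).
Proof.
(* This dominates the absolute value of anything between [flow] and [upper]: there [upper - flow] is
   nonnegative and the negated value is at most [|flow|]. *)
have iY : integrableR P (fun w => upper w + (`|flow| - flow)).
  by apply: integrableRD => //; exact: integrableR_cst.
apply: (ae_le_integrableR _ iY); first exact: measurable_f_comp.
move: next_le; apply: filterS => w fu; have := f_low (next k w) => low.
rewrite ler_norml; apply/andP; split; have := ler_norm (- flow);
  have := ler_norm flow; rewrite normrN; lra.
Qed.

(** In the mean of [upper] the term <H g, e> vanishes, and the quadratic term splits into a gradient
    part, absorbed in [decrease_coef k], and a noise part. *)
Lemma mean_f_next_le : mean P (fun w => f (next k w)) <=
  mean P (fun w => f (x k w)) -
  decrease_coef k * mean P (fun w => enorm (grad f (x k w)) ^+ 2) +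
  L * M ^+ 2 * sigma ^+ 2 / 2 * (alpha k ^+ 2 / (b k)%:R).
Proof.
apply: (le_trans (ae_le_mean integrable_f_next iupper next_le)).
have i3 : integrableR P (fun w => - alpha k * dotv (H w *m g w) (e w)).
  exact: integrableRZ.
have i4 := integrableRZ (L / 2 * alpha k ^+ 2 * M ^+ 2) isq.
have i2 := integrableRZ (- (alpha k * m)) igg.
rewrite /upper meanD//; last by apply: integrableRD => //; exact: integrableRD.
rewrite meanD//; last exact: integrableRD.
rewrite meanD// !meanZ// mean_sq.
rewrite mean_dotv_avg_noise//; last by move=> j; exact: measurable_scaling_grad.
have -> : mean P (fun w => enorm (grad f (x k w)) ^+ 2) =
    mean P (fun w => dotv (g w) (g w)).
  by congr mean; apply/funext => w; rewrite enorm_sqr.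
have := ler_wpM2l (mulr_ge0 (mulr_ge0 (ltW (divr_gt0 L_gt0 (ltr0n R 2)))
  (sqr_ge0 (alpha k))) (sqr_ge0 M)) (mean_sqr_avg_noise kN).
rewrite /decrease_coef.
move: (mean P (fun w => dotv (e w) (e w))) (mean P (fun w => dotv (g w) (g w))) => a c le.
have -> : L * M ^+ 2 * sigma ^+ 2 / 2 * (alpha k ^+ 2 / (b k)%:R) =
  L / 2 * alpha k ^+ 2 * M ^+ 2 * (sigma ^+ 2 / (b k)%:R) by ring.
move: (sigma ^+ 2 / _) le => t; lra.
Qed.

End one_step.

(** * Telescoping over the iterations *)

Hypothesis alpha_ge0 : forall k, (1 <= k <= N)%N -> 0 <= alpha k.

Let noise_term k : R := L * M ^+ 2 * sigma ^+ 2 / 2 * (alpha k ^+ 2 / (b k)%:R).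

Lemma x_next k : (1 <= k < N)%N -> x k.+1 = next k.
Proof. by move=> kN; apply/funext => w; rewrite x_step. Qed.

(** Integrability starts from the deterministic [x1] and is propagated by the one-step lemmas. *)
Lemma integrable_iterate k : (1 <= k <= N)%N ->
  (forall j, square_integrable P (fun w => grad f (x k w) j 0)) /\
  integrableR P (fun w => f (x k w)).
Proof.
elim: k => // -[_ _|k ih /andP[_ kN]].
  split => [j|]; under eq_fun do rewrite x_init.
    exact: square_integrable_cst.
  exact: integrableR_cst.
have kN' : (1 <= k.+1 <= N)%N by rewrite (ltnW kN).
have [sg ifx] := ih kN'; rewrite x_next//; split => [j|].
  exact: square_integrable_grad_next.
exact: integrable_f_next (alpha_ge0 kN') sg ifx.
Qed.

(** Stated through [next] so that it also makes sense after the last step [K = N]. *)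
Let mean_f_after K : R := if K is 0 then f x1 else mean P (fun w => f (next K w)).

Lemma sum_decrease_le K : (K <= N)%N ->
  \sum_(1 <= k < K.+1) decrease_coef k * mean P (fun w => enorm (grad f (x k w)) ^+ 2) <=
  f x1 - mean_f_after K +
  \sum_(1 <= k < K.+1) noise_term k.
Proof.
elim: K => [_|K ih KN]; first by rewrite !big_geq// subrr addr0.
have K1N : (1 <= K.+1 <= N)%N by [].
rewrite big_nat_recr//= [X in _ <= _ + X]big_nat_recr//=.
have [sg ifx] := integrable_iterate K1N.
have := mean_f_next_le K1N (alpha_ge0 K1N) sg ifx; rewrite -/(noise_term K.+1).
have -> : mean P (fun w => f (x K.+1 w)) = mean_f_after K.
  case: K KN {ih K1N sg ifx} => [|K] KN; last by rewrite x_next.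
  by under eq_fun do rewrite x_init; rewrite mean_cst.
rewrite -[mean P (fun w => f (next K.+1 w))]/(mean_f_after K.+1).
by have := ih (ltnW KN); lra.
Qed.

(** The value at the fictitious iterate left over by telescoping is at least [flow]. *)
Lemma sum_decrease_total_le : (0 < N)%N ->
  \sum_(1 <= k < N.+1) decrease_coef k * mean P (fun w => enorm (grad f (x k w)) ^+ 2) <=
  f x1 - flow +
  L * M ^+ 2 * sigma ^+ 2 / 2 * \sum_(1 <= k < N.+1) alpha k ^+ 2 / (b k)%:R.
Proof.
move=> N0; have NN : (1 <= N <= N)%N by rewrite N0 leqnn.
apply: (le_trans (sum_decrease_le (leqnn N))); rewrite -mulr_sumr lerD2r lerB//.
have [sg ifx] := integrable_iterate NN.
have -> : mean_f_after N = mean P (fun w => f (next N w)).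
  by rewrite /mean_f_after; case: N N0.
rewrite -[leLHS](mean_cst P).
apply: ae_le_mean; [exact: integrableR_cst| |exact: aeW].
exact: integrable_f_next (alpha_ge0 NN) sg ifx.
Qed.

(** * Averaging over the random index *)

Section random_index.
Variable r : Omega -> nat.
Hypotheses (r_meas : measurable_fun [set: Omega] r)
  (r_indep : forall A C : set Omega, sigma_of r A -> sigma_batches b xi N C ->
     P (A `&` C) = (P A * P C)%E).

(** Freezing once more, with all samples as the past and [r] as the fresh variable: the inner
    integral of the indicator is the probability of [k]. *)
Lemma integral_index_eq k : (1 <= k <= N)%N ->
  (\int[P]_w ((r w == k)%:R * enorm (grad f (x k w)) ^+ 2)%:E =
   P [set w | r w = k] * (mean P (fun w => enorm (grad f (x k w)) ^+ 2))%:E)%E.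
Proof.
move=> kN; have mS := @history_sub_measurable N.+1 0.
have mV : measurable_fun setT (fun w : Om N.+1 0 => enorm (grad f (x k w)) ^+ 2).
  under eq_fun do rewrite enorm_sqr; apply: measurable_dotv => j;
  by apply: measurable_history_mono (measurable_grad_x kN j);
    rewrite ltnS; case/andP: kN => _ ->.
have rE : r @^-1` [set k] = [set w | r w = k] by [].
have mrk : measurable [set w | r w = k].
  by rewrite -rE -[X in measurable X]setTI; exact: r_meas.
rewrite (ge0_integral_freezing (S := history N.+1 0) mS r_meas _
  (h := fun z => ((z.2 == k)%:R * enorm (grad f (x k z.1)) ^+ 2)%:E)).
- have inner w0 : (\int[P]_w ((r w == k)%:R * enorm (grad f (x k w0)) ^+ 2)%:E =
      P [set w | r w = k] * (enorm (grad f (x k w0)) ^+ 2)%:E)%E.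
    under eq_integral do rewrite EFinM.
    rewrite ge0_integralZr//; last by rewrite lee_fin sqr_ge0.
      congr (_ * _)%E.
      transitivity (\int[P]_w (\1_[set w | r w = k] w)%:E)%E; last first.
        by rewrite integral_indic// setIT.
      apply: eq_integral => w _; rewrite indicE; congr (nat_of_bool _)%:R%:E.
      by apply/idP/idP; rewrite in_setE => /eqP.
    apply/measurable_EFinP.
    exact: (measurableT_comp (_ : measurable_fun setT (fun l : nat => (l == k)%:R : R)) r_meas).
  under eq_integral do rewrite inner.
  rewrite ge0_integralZl//.
  + rewrite mean_EFin//.
    under eq_fun do rewrite enorm_sqr.
    by apply: integrable_dotv; have [] := integrable_iterate kN.
  + by apply/measurable_EFinP; exact: (measurable_fun_generated mS).
  + by move=> w _; rewrite lee_fin sqr_ge0.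
- move=> A U sA mU; rewrite setIC muleC r_indep//; first by exists U.
  move: A sA; apply: smallest_sub; first exact: smallest_sigma_algebra.
  exact: history_sigma_batches.
- apply/measurable_EFinP; apply: measurable_funM.
    exact: (measurableT_comp (_ : measurable_fun setT (fun l : nat => (l == k)%:R : R))).
  exact: (measurableT_comp mV).
- by move=> z; rewrite lee_fin mulr_ge0 ?sqr_ge0.
Qed.

Lemma integral_random_index : (forall w, (1 <= r w <= N)%N) ->
  (\int[P]_w (enorm (grad f (x (r w) w)) ^+ 2)%:E =
   \sum_(1 <= k < N.+1) P [set w | r w = k] *
     (mean P (fun w => enorm (grad f (x k w)) ^+ 2))%:E)%E.
Proof.
move=> r_range.
have valid (i : 'I_N) : (1 <= i.+1 <= N)%N by rewrite ltn_ord.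
rewrite big_add1 big_mkord /=.
under [RHS]eq_bigr do rewrite -integral_index_eq//.
rewrite -ge0_integral_sum//.
- apply: eq_integral => w _; have /andP[r1 rN] := r_range w.
  (* Ordinals start at 0 and indices at 1, so the only surviving summand is at [(r w).-1]. *)
  have rp : ((r w).-1 < N)%N by rewrite prednK.
  rewrite (bigD1 (Ordinal rp))//= prednK// eqxx mul1r big1 ?adde0// => i iD.
  case: eqP => [rw|_]; last by rewrite mul0r.
  by move: iD; rewrite -(inj_eq val_inj)/= rw/= eqxx.
- move=> i; apply/measurable_EFinP; apply: measurable_funM.
    exact: (measurableT_comp (_ : measurable_fun setT (fun l : nat => (l == i.+1)%:R : R)) r_meas).
  apply: (measurable_fun_generated (@history_sub_measurable i.+1 0)).
  under eq_fun do rewrite enorm_sqr.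
  by apply: measurable_dotv => j; exact: measurable_grad_x.
- by move=> i w _; rewrite lee_fin mulr_ge0 ?sqr_ge0.
Qed.

End random_index.

End quasi_newton.

Theorem theorem3p1 (R : realType) (n p : nat)
  (* objective and its assumptions *)
  (f : 'cV[R]_n -> R) (flow L : R)
  (f_C1 : continuously_differentiable f)
  (f_low : forall x, flow <= f x)
  (L_gt0 : 0 < L)
  (grad_lip : forall x y, enorm (grad f x - grad f y) <= L * enorm (x - y))
  (* stochastic first-order oracle *)
  (G : 'cV[R]_n -> 'cV[R]_p -> 'cV[R]_n)
  (G_meas : measurable_fun [set: borel_mx R n 1 * borel_mx R p 1]
     (fun z : borel_mx R n 1 * borel_mx R p 1 => G z.1 z.2 : borel_mx R n 1))
  (Xi : set 'cV[R]_p)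
  (* parameters of the algorithm *)
  (N : nat) (N_gt0 : (1 <= N)%N)
  (x1 : 'cV[R]_n) (B1 : 'M[R]_n) (B1_spd : spd B1)
  (alpha zeta : nat -> R) (b : nat -> nat)
  (b_gt0 : forall k, (1 <= k <= N)%N -> (1 <= b k)%N)
  (zeta_gt0 : forall k, (1 <= k <= N)%N -> 0 < zeta k)
  (* samples: [xi k i], for [1 <= k <= N] and [i < b k] *)
  (d : measure_display) (Omega : measurableType d) (P : probability Omega R)
  (xi : nat -> nat -> Omega -> 'cV[R]_p)
  (xi_meas : forall k i, (1 <= k <= N)%N -> (i < b k)%N ->
     measurable_fun [set: Omega] (xi k i : Omega -> borel_mx R p 1))
  (xi_supp : forall k i, (1 <= k <= N)%N -> (i < b k)%N ->
     {ae P, forall w, Xi (xi k i w)})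
  (xi_indep : mutually_independent P
     [set ki : nat * nat | (1 <= ki.1 <= N)%N && (ki.2 < b ki.1)%N]
     (fun ki => sigma_of (xi ki.1 ki.2 : Omega -> borel_mx R p 1)))
  (* iterates and quasi-Newton matrices *)
  (x : nat -> Omega -> 'cV[R]_n) (B : nat -> Omega -> 'M[R]_n)
  (x_init : forall w, x 1%N w = x1)
  (x_step : forall k w, (1 <= k < N)%N ->
     x k.+1 w = x k w - alpha k *:
       ((invmx (B k w) + (zeta k)%:M) *m
          minibatch G (b k) (x k w) (fun i => xi k i w)))
  (B_init : forall w, B 1%N w = B1)
  (B_spd : forall k w, (1 <= k <= N)%N -> spd (B k w))
  (B_adapted : forall k, (2 <= k <= N)%N -> forall U : set (borel_mx R n n),
     measurable U -> sigma_batches b xi k.-1 (B k @^-1` U))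
  (* uniform bounds on the scaling matrices *)
  (m M : R) (m_gt0 : 0 < m) (M_gt0 : 0 < M)
  (B_bounds : forall k, (1 <= k <= N)%N ->
     {ae P, forall w, loewner_le m%:M (invmx (B k w) + (zeta k)%:M) /\
                      loewner_le (invmx (B k w) + (zeta k)%:M) M%:M})
  (* unbiasedness and bounded variance: expectation over [xi k i] only, with
     the value [x k w0] of the iterate held fixed *)
  (sigma : R) (sigma_gt0 : 0 < sigma)
  (G_unbiased : forall k i, (1 <= k <= N)%N -> (i < b k)%N ->
     {ae P, forall w0, forall j : 'I_n,
        ('E_P[(fun w => G (x k w0) (xi k i w) j 0)%R] = (grad f (x k w0) j 0)%:E)%E})
  (G_variance : forall k i, (1 <= k <= N)%N -> (i < b k)%N ->
     {ae P, forall w0,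
        ('E_P[(fun w => enorm (G (x k w0) (xi k i w) - grad f (x k w0)) ^+ 2)%R]
          <= (sigma ^+ 2)%:E)%E})
  (* stepsizes *)
  (alpha_range : forall k, (1 <= k <= N)%N ->
     0 < alpha k <= 2 * m / (L * M ^+ 2))
  (alpha_strict : exists2 k, (1 <= k <= N)%N & alpha k < 2 * m / (L * M ^+ 2))
  (* random stopping index *)
  (r : Omega -> nat) (r_meas : measurable_fun [set: Omega] r)
  (r_range : forall w, (1 <= r w <= N)%N)
  (r_indep : forall A C : set Omega, sigma_of r A -> sigma_batches b xi N C ->
     P (A `&` C) = (P A * P C)%E)
  (r_pmf : forall k, (1 <= k <= N)%N ->
     P [set w | r w = k] =
       ((m * alpha k - L * M ^+ 2 * alpha k ^+ 2 / 2) /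
        \sum_(1 <= j < N.+1) (m * alpha j - L * M ^+ 2 * alpha j ^+ 2 / 2))%:E) :
  ('E_P[(fun w => enorm (grad f (x (r w) w)) ^+ 2)%R] <=
   ((f x1 - flow
       + L * M ^+ 2 * sigma ^+ 2 / 2 *
         \sum_(1 <= k < N.+1) alpha k ^+ 2 / (b k)%:R) /
    \sum_(1 <= k < N.+1) (m * alpha k - L * M ^+ 2 * alpha k ^+ 2 / 2))%:E)%E.
Proof.
have LM_gt0 : 0 < L * M ^+ 2 by rewrite mulr_gt0// exprn_gt0.
(* Factored form: for a positive stepsize the sign is that of its gap below the admissible
   maximum. *)
have coefE k : m * alpha k - L * M ^+ 2 * alpha k ^+ 2 / 2 =
    L * M ^+ 2 / 2 * alpha k * (2 * m / (L * M ^+ 2) - alpha k).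
  by field; rewrite !gt_eqF.
have alpha_ge0 k : (1 <= k <= N)%N -> 0 <= alpha k by move=> /alpha_range/andP[/ltW].
have coef_ge0 k : (1 <= k < N.+1)%N ->
    0 <= m * alpha k - L * M ^+ 2 * alpha k ^+ 2 / 2.
  move=> kN; have /andP[a0 aM] := alpha_range k kN.
  rewrite coefE mulr_ge0 ?subr_ge0//.
  by rewrite mulr_ge0 ?(ltW a0)// divr_ge0// ltW.
have sum_gt0 : 0 < \sum_(1 <= k < N.+1) (m * alpha k - L * M ^+ 2 * alpha k ^+ 2 / 2).
  (* The strictly admissible stepsize makes one summand positive, which makes the normalizing sum
     positive. *)
  have [k0 k0N k0M] := alpha_strict.
  have k0i : k0 \in index_iota 1 N.+1 by rewrite mem_index_iota.
  rewrite (bigD1_seq k0) ?iota_uniq//= ltr_wpDr//.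
    by rewrite big_seq_cond sumr_ge0// => k /andP[]; rewrite mem_index_iota => /coef_ge0.
  have /andP[a0 _] := alpha_range k0 k0N.
  by rewrite coefE mulr_gt0 ?subr_gt0// mulr_gt0// divr_gt0.
rewrite unlock (integral_random_index f_C1 f_low L_gt0 grad_lip G_meas b_gt0 xi_meas
  xi_indep x_init x_step B_init B_spd B_adapted m_gt0 M_gt0 B_bounds
  G_variance alpha_ge0 r_meas r_indep r_range).
(* Inserting the law of [r] turns the expectation into the telescoped weighted sum over the
   normalizing constant, which then cancels. *)
rewrite big_seq; under eq_bigr => k.
  rewrite mem_index_iota => kN; rewrite r_pmf// -EFinM mulrAC.
  over.
rewrite -big_seq sumEFin lee_fin -mulr_suml ler_pM2r ?invr_gt0//.
exact: (sum_decrease_total_le f_C1 f_low L_gt0 grad_lip G_meas b_gt0 xi_meas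
  xi_indep x_init x_step B_init B_spd B_adapted m_gt0 M_gt0 B_bounds G_unbiased
  G_variance alpha_ge0 N_gt0).
Qed.
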